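(* Let $\mathcal{I}$ be a subset of $\mathcal{V}(E)$. For $V\in\mathcal{V}(E)$ set $\mathcal{I}(V)=\{I\in\mathcal{I}\mid I\leq V\}$ and denote by $\mathcal{I}_{\max}(V)$ the set of subspaces in $\mathcal{I}(V)$ of maximal dimension. Suppose $\mathcal{I}$ satisfies the following. (I1) $\{0\}\in\mathcal{I}$. (I2) If $I\in\mathcal{I}$ and $J\leq I$, then $J\in\mathcal{I}$. (I3) If $I,J\in\mathcal{I}$ and $\dim I<\dim J$, then there exists $x\in J\setminus I$ such that $I\oplus\langle x\rangle\in\mathcal{I}$. (I4) Let $V,W\in\mathcal{V}(E)$ and $I\in\mathcal{I}_{\max}(V)$, $J\in\mathcal{I}_{\max}(W)$. Then there exists a space $K\in\mathcal{I}_{\max}(V+W)$ that is contained in $I+J$. Furthermore, let $\tilde{\rho}:\mathcal{I}\longrightarrow\mathbb{Q}$ and $\mu\in\mathbb{Q}_{>0}$ be such that $\mu\tilde{\rho}(I)\in\mathbb{Z}$ for all $I\in\mathcal{I}$. Suppose $\tilde{\rho}$ satisfies the following. (R1$'$) $0\leq \mu^{-1}\dim I\leq\tilde{\rho}(I)\leq\dim I$ for all $I\in\mathcal{I}$. (R2$'$) If $I,J\in\mathcal{I}$ are such that $I\leq J$, then $\tilde{\rho}(I)\leq\tilde{\rho}(J)$. (R3$'$) For all $I,J\in\mathcal{I}$ we have $\max\{\tilde{\rho}(K)\mid K\in\mathcal{I}(I+J)\}+\tilde{\rho}(I\cap J)\leq \tilde{\rho}(I)+\tilde{\rho}(J)$.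 (R4$'$) For all $V\in\mathcal{V}(E)$ and $I,J\in\mathcal{I}_{\max}(V)$ we have $\tilde{\rho}(I)=\tilde{\rho}(J)$. Define the map \[ \rho:\mathcal{V}(E)\longrightarrow\mathbb{Q},\quad V\longmapsto \max\{\tilde{\rho}(I)\mid I\in\mathcal{I}(V)\}. \] Then $\mathcal{M}=(E,\rho)$ is a $q$-polymatroid with denominator $\mu$, and $\mathcal{I}\subseteq\mathcal{I}_\mu(\mathcal{M})$.
   Context: Throughout, $\mathbb{F}=\mathbb{F}_q$ is a finite field and $E$ is a finite-dimensional $\mathbb{F}$-vector space. $V\leq W$ means that $V$ is a subspace of $W$, $\mathcal{V}(E)$ is the set of all subspaces of $E$, and $\langle x\rangle$ is the span of $x$. A $q$-rank function on $E$ is a map $\rho:\mathcal{V}(E)\to\mathbb{Q}_{\geq0}$ such that for all $V,W\in\mathcal{V}(E)$: (R1) $0\leq\rho(V)\leq\dim V$; (R2) $V\leq W$ implies $\rho(V)\leq\rho(W)$; (R3) $\rho(V+W)+\rho(V\cap W)\leq\rho(V)+\rho(W)$. A $q$-polymatroid on $E$ is a pair $\mathcal{M}=(E,\rho)$ with $\rho$ a $q$-rank function on $E$. A number $\mu\in\mathbb{Q}_{>0}$ is a denominator of $\mathcal{M}$ if $\mu\rho(V)\in\mathbb{N}_0$ for all $V\in\mathcal{V}(E)$. Let $\mathcal{M}=(E,\rho)$ be a $q$-polymatroid with denominator $\mu$. A space $I\in\mathcal{V}(E)$ is $\mu$-independent if $\rho(J)\geq\frac{\dim J}{\mu}$ for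 all subspaces $J\leq I$. Set $\mathcal{I}_\mu(\mathcal{M})=\{I\in\mathcal{V}(E)\mid I \text{ is } \mu\text{-independent}\}$. *)

(* Defs.v *)
From HB Require Import structures.
From mathcomp Require Import all_boot all_order all_algebra.

Set Implicit Arguments.
Unset Strict Implicit.
Unset Printing Implicit Defensive.

Import Order.TTheory GRing.Theory Num.Theory.
Local Open Scope ring_scope.

(* A subspace is encoded by a square matrix over F, so {vspace E} is finite as
   soon as F is. The subType instance used here is only in scope after
   importing VectorInternalTheory. *)
Module VspaceFinite.
Import VectorInternalTheory.
#[export] HB.instance Definition _ (F : finFieldType) (E : vectType F) :=
  [Countable of {vspace E} by <:].
#[export] HB.instance Definition _ (F : finFieldType) (E : vectType F) :=
  [Finite of {vspace E} by <:].
Module Exports. HB.reexport. End Exports.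
End VspaceFinite.
Export VspaceFinite.Exports.

Definition q_rank_function (F : finFieldType) (E : vectType F)
    (rho : {vspace E} -> rat) : Prop :=
  [/\ forall V : {vspace E}, 0 <= rho V <= (\dim V)%:R,
      forall V W : {vspace E}, (V <= W)%VS -> rho V <= rho W
    & forall V W : {vspace E},
        rho (V + W)%VS + rho (V :&: W)%VS <= rho V + rho W].

(* In the pair (E, rho), the component E is recorded in the type. *)
Record qpolymatroid (F : finFieldType) (E : vectType F) := QPolymatroid {
  qrank :> {vspace E} -> rat;
  qrankP : q_rank_function qrank
}.

Definition denominator (F : finFieldType) (E : vectType F)
    (M : qpolymatroid E) (mu : rat) : Prop :=
  0 < mu /\ forall V : {vspace E}, mu * M V \is a Num.nat.

Definition mu_independent (F : finFieldType) (E : vectType F)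
    (M : qpolymatroid E) (mu : rat) (I : {vspace E}) : bool :=
  [forall J : {vspace E}, (J <= I)%VS ==> ((\dim J)%:R / mu <= M J)].

Definition independent_spaces (F : finFieldType) (E : vectType F)
    (M : qpolymatroid E) (mu : rat) : {set {vspace E}} :=
  [set I | mu_independent M mu I].

Definition spaces_in (F : finFieldType) (E : vectType F)
    (calI : {set {vspace E}}) (V : {vspace E}) : {set {vspace E}} :=
  [set I in calI | (I <= V)%VS].

Definition max_spaces_in (F : finFieldType) (E : vectType F)
    (calI : {set {vspace E}}) (V : {vspace E}) : {set {vspace E}} :=
  [set I in spaces_in calI V |
    [forall J in spaces_in calI V, (\dim J <= \dim I)%N]].

(* The maximum of f over spaces_in calI V. The arg max notation needs a member
   of that set as a witness that it is nonempty; 0%VS is one whenever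
   0%VS \in calI (otherwise the value may be meaningless). *)
Definition max_over (F : finFieldType) (E : vectType F)
    (calI : {set {vspace E}}) (f : {vspace E} -> rat) (V : {vspace E}) : rat :=
  f [arg max_(I > 0%VS in spaces_in calI V) f I]%O.

Lemma max_overP (F : finFieldType) (E : vectType F)
    (calI : {set {vspace E}}) (f : {vspace E} -> rat) (V : {vspace E}) :
  0%VS \in calI ->
  (exists2 I, I \in spaces_in calI V & max_over calI f V = f I) /\
  (forall I, I \in spaces_in calI V -> f I <= max_over calI f V).
Proof.
move=> calI0; rewrite /max_over; case: arg_maxP => [|I IV maxI].
  by rewrite inE calI0 sub0v.
by split=> //; exists I.
Qed.

(* Main.v *)
Require Import Defs.
From mathcomp Require Import all_boot all_order all_algebra.

Import Order.TTheory GRing.Theory Num.Theory.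
Local Open Scope ring_scope.

(** A max over the members of [calI] inside [V] is hard to compare for
    different spaces [V]; the whole proof rests on replacing it by the value of
    [rhot] at a basis of [V], meaning any member of [calI] inside [V] of maximal
    dimension.

    By the exchange property, every member of [calI] inside [V] extends to a
    basis of [V] ([extend_to_basis]).  As [rhot] is monotone and takes the same
    value on all bases of [V], that value is the max ([max_over_basis]).

    Submodularity for [V] and [W] then follows from a compatible choice of
    bases, as for matroids: extend a basis [K] of [V :&: W] to a basis [I] of
    [V] and to a basis [J] of [W].  By maximality of [K] we get [I :&: J = K],
    so the submodularity (R3') of [rhot] at [I] and [J] involves the right
    values on three of the four spaces.  For the fourth, (I4) places some basis
    of [V + W] inside [I + J], so the max over [I + J] bounds the max over
    [V + W].  The remaining properties transfer directly from [rhot], because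
    the max is attained. *)

Lemma max_spaces_inP {F : finFieldType} {E : vectType F}
    {calI : {set {vspace E}}} {V I : {vspace E}} :
  reflect [/\ I \in calI, (I <= V)%VS
            & forall J, J \in calI -> (J <= V)%VS -> (\dim J <= \dim I)%N]
          (I \in max_spaces_in calI V).
Proof.
rewrite !inE; apply: (iffP andP) => [[/andP[cI IV] /forall_inP maxI]|].
  by split=> // J cJ JV; apply: maxI; rewrite inE cJ.
case=> cI IV maxI; split; first exact/andP.
by apply/forall_inP => J; rewrite inE => /andP[]; apply: maxI.
Qed.

(** Among the members of [calI] between [I] and [V], one of largest dimension is
    a basis of [V]: a strictly larger member inside [V] would provide, by
    exchange, a vector that enlarges it within [V]. *)
Lemma extend_to_basis {F : finFieldType} {E : vectType F}
    {calI : {set {vspace E}}} {V I : {vspace E}} :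
  (forall I J : {vspace E}, I \in calI -> J \in calI ->
     (\dim I < \dim J)%N ->
     exists x : E, [/\ x \in J, x \notin I, directv (I + <[x]>)
                     & (I + <[x]>)%VS \in calI]) ->
  I \in calI -> (I <= V)%VS ->
  exists2 B : {vspace E}, B \in max_spaces_in calI V & (I <= B)%VS.
Proof.
move=> exch cI IV.
pose between (B : {vspace E}) := [&& B \in calI, (I <= B)%VS & (B <= V)%VS].
have betweenI : between I by rewrite /between cI subvv IV.
case: (arg_maxnP (fun B : {vspace E} => \dim B) betweenI).
move=> B /and3P[cB IB BV] maxB; exists B => //.
apply/max_spaces_inP; split=> // J cJ JV; rewrite leqNgt; apply/negP => ltBJ.
have [x [xJ xnB _ cBx]] := exch _ _ cB cJ ltBJ.
have : between (B + <[x]>)%VS.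
  rewrite /between cBx (subv_trans IB (addvSl _ _)) subv_add BV -memvE.
  exact: subvP JV _ xJ.
move/maxB; apply/negP; rewrite -ltnNge.
rewrite (ltn_leqif (dimv_leqif_sup (addvSl _ _))) subv_add subvv /=.
by rewrite -memvE.
Qed.

(** A member of [calI] where the max is attained need not be a basis, but it
    extends to one without lowering [rhot], and all bases give the same value. *)
Lemma max_over_basis (F : finFieldType) (E : vectType F)
    (calI : {set {vspace E}}) (rhot : {vspace E} -> rat) (V B : {vspace E}) :
  0%VS \in calI ->
  (forall I J : {vspace E}, I \in calI -> J \in calI ->
     (\dim I < \dim J)%N ->
     exists x : E, [/\ x \in J, x \notin I, directv (I + <[x]>)
                     & (I + <[x]>)%VS \in calI]) ->
  (forall I J : {vspace E}, I \in calI -> J \in calI ->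
     (I <= J)%VS -> rhot I <= rhot J) ->
  (forall I J : {vspace E},
     I \in max_spaces_in calI V -> J \in max_spaces_in calI V ->
     rhot I = rhot J) ->
  B \in max_spaces_in calI V -> max_over calI rhot V = rhot B.
Proof.
move=> c0 exch mono cst basisB.
have [cB BV _] := max_spaces_inP basisB.
have [[I + maxE] ubV] := max_overP rhot V c0; rewrite inE => /andP[cI IV].
apply/le_anti; rewrite (ubV B) ?inE ?cB ?BV // andbT maxE.
have [B' basisB' IB'] := extend_to_basis exch cI IV.
have [cB' _ _] := max_spaces_inP basisB'.
by rewrite (cst _ _ basisB basisB') mono.
Qed.

(** The intersection [I :&: J] is again in [calI] and lies inside [V :&: W], so
    it cannot have larger dimension than the basis [K] that it contains. *)
Lemma basis_capv {F : finFieldType} {E : vectType F}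
    {calI : {set {vspace E}}} {V W I J K : {vspace E}} :
  (forall I J : {vspace E}, I \in calI -> (J <= I)%VS -> J \in calI) ->
  K \in max_spaces_in calI (V :&: W)%VS ->
  I \in max_spaces_in calI V -> J \in max_spaces_in calI W ->
  (K <= I)%VS -> (K <= J)%VS -> (I :&: J)%VS = K.
Proof.
move=> down /max_spaces_inP[_ _ maxK] /max_spaces_inP[cI IV _].
move=> /max_spaces_inP[_ JW _] KI KJ.
apply/esym/eqP; rewrite eqEdim subv_cap KI KJ /=.
by apply: maxK; [apply: down cI (capvSl _ _) | apply: capvS].
Qed.

Theorem theorem4p4 (F : finFieldType) (E : vectType F)
  (calI : {set {vspace E}})
  (I1 : 0%VS \in calI)
  (I2 : forall I J : {vspace E}, I \in calI -> (J <= I)%VS -> J \in calI)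
  (I3 : forall I J : {vspace E}, I \in calI -> J \in calI ->
     (\dim I < \dim J)%N ->
     exists x : E, [/\ x \in J, x \notin I, directv (I + <[x]>)
                     & (I + <[x]>)%VS \in calI])
  (I4 : forall V W I J : {vspace E},
     I \in max_spaces_in calI V -> J \in max_spaces_in calI W ->
     exists2 K : {vspace E}, K \in max_spaces_in calI (V + W)%VS
                           & (K <= I + J)%VS)
  (rhot : {vspace E} -> rat) (* only its values on calI matter *)
  (mu : rat) (mu_gt0 : 0 < mu)
  (mu_rhot : forall I : {vspace E}, I \in calI -> mu * rhot I \is a Num.int)
  (R1' : forall I : {vspace E}, I \in calI ->
     [/\ 0 <= mu^-1 * (\dim I)%:R, mu^-1 * (\dim I)%:R <= rhot I
       & rhot I <= (\dim I)%:R])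
  (R2' : forall I J : {vspace E}, I \in calI -> J \in calI ->
     (I <= J)%VS -> rhot I <= rhot J)
  (R3' : forall I J : {vspace E}, I \in calI -> J \in calI ->
     max_over calI rhot (I + J)%VS + rhot (I :&: J)%VS <= rhot I + rhot J)
  (R4' : forall V I J : {vspace E},
     I \in max_spaces_in calI V -> J \in max_spaces_in calI V ->
     rhot I = rhot J) :
  exists M : qpolymatroid E,
    [/\ forall V : {vspace E}, M V = max_over calI rhot V,
        denominator M mu
      & calI \subset independent_spaces M mu].
Proof.
pose rho := max_over calI rhot.
have rho_basis V B : B \in max_spaces_in calI V -> rho V = rhot B.
  by apply: max_over_basis => //; apply: R4'.
have rho_ub V I : I \in calI -> (I <= V)%VS -> rhot I <= rho V.
  by move=> cI IV; apply: (max_overP rhot V I1).2; rewrite inE cI.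
have rho_attained V : exists I, [/\ I \in calI, (I <= V)%VS & rho V = rhot I].
  have [[I + rhoV] _] := max_overP rhot V I1.
  by rewrite inE => /andP[cI IV]; exists I.
have rho_ge0 V : 0 <= rho V.
  have [I [cI _ ->]] := rho_attained V.
  by have [ge0 le_rhot _] := R1' _ cI; apply: le_trans le_rhot.
have rhoP : q_rank_function rho.
  split=> [V|V W VW|V W].
  - rewrite rho_ge0; have [I [cI IV ->]] := rho_attained V.
    have [_ _ rhotI_le] := R1' _ cI.
    by rewrite (le_trans rhotI_le) // ler_nat dimvS.
  - have [I [cI IV ->]] := rho_attained V.
    exact: rho_ub cI (subv_trans IV VW).
  - have [K basisK _] := extend_to_basis I3 I1 (sub0v (V :&: W)%VS).
    have [cK KVW _] := max_spaces_inP basisK.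
    have /andP[KV KW] : (K <= V)%VS && (K <= W)%VS by rewrite -subv_cap.
    have [I basisI KI] := extend_to_basis I3 cK KV.
    have [J basisJ KJ] := extend_to_basis I3 cK KW.
    have [L basisL LIJ] := I4 _ _ _ _ basisI basisJ.
    have [cI _ _] := max_spaces_inP basisI.
    have [cJ _ _] := max_spaces_inP basisJ.
    have [cL _ _] := max_spaces_inP basisL.
    rewrite (rho_basis _ _ basisI) (rho_basis _ _ basisJ).
    rewrite (rho_basis _ _ basisK) (rho_basis _ _ basisL).
    apply: le_trans (R3' _ _ cI cJ).
    by rewrite (basis_capv I2 basisK basisI basisJ KI KJ) lerD2r rho_ub.
exists (QPolymatroid rhoP); split=> //.
  split=> // V; rewrite natrEint mulr_ge0 ?(ltW mu_gt0) ?rho_ge0 // andbT.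
  by have [I [cI _ /= ->]] := rho_attained V; apply: mu_rhot.
apply/subsetP => I cI; rewrite inE; apply/forall_inP => J JI.
have cJ := I2 _ _ cI JI; have [_ rhotJ_ge _] := R1' _ cJ.
by rewrite mulrC (le_trans rhotJ_ge) // rho_ub.
Qed.
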